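(* Let $x^* \in \operatorname{dom} f$ be a point of local minimum of the problem $$\min f(x) \quad \text{subject to} \quad y_0 \in \Phi(x), \quad x \in A,$$ let $f$ be Lipschitz continuous near $x^*$, and let $\Phi$ be metrically subregular with respect to the set $A$ with constant $a > 0$ at $(x^*, y_0)$. Suppose also that: (1) there exist $\phi_0 > 0$ and $t_0 > 0$ such that $\phi(t) \ge \phi_0 t$ for all $t \in [0,t_0]$; (2) there exist $\beta_0 > 0$ and $\overline{\mu} > 0$ such that $\beta(\mu) \ge \beta_0 \mu$ for all $\mu \in [0,\overline{\mu}]$. Then the penalty function $F_\lambda(x,\mu)$ is exact at $x^*$. Moreover, $$\lambda(x^* ) \le \frac{L^2}{4 \phi_0 \beta_0 a^2},$$ where $L \ge 0$ is a Lipschitz constant of $f$ near $x^*$.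
   Context: Setting. Let $X$ and $Y$ be metric spaces (both metrics denoted $d$), $A \subset X$ a nonempty set, $\Phi \colon X \rightrightarrows Y$ a set-valued mapping with closed images, $y_0 \in Y$, and $f \colon X \to \mathbb{R} \cup \{+\infty\}$ with $\operatorname{dom} f = \{x \in X \mid f(x) < +\infty\}$. Write $\mathbb{R}_+ = [0,+\infty)$, $d(x_0,C) = \inf_{x \in C} d(x_0,x)$ for the distance from a point to a set (equal to $+\infty$ if $C = \emptyset$), and $\Phi^{-1}(y) = \{x \in X \mid y \in \Phi(x)\}$. The feasible set of the problem is $\Omega = \Phi^{-1}(y_0) \cap A$, assumed nonempty, and $f$ is assumed bounded below on $\Omega$. A point of local minimum of the problem is a point $x^* \in \Omega$ such that $f(x) \ge f(x^* )$ for all $x \in \Omega$ in some neighbourhood of $x^*$. Let $\phi \colon \mathbb{R}_+ \cup \{+\infty\} \to \mathbb{R}_+ \cup \{+\infty\}$ be non-decreasing with $\phi(t) = 0$ iff $t = 0$, and let $\beta \colon \mathbb{R}_+ \to \mathbb{R}_+ \cup \{+\infty\}$ be non-decreasing with $\beta(\mu) = 0$ iff $\mu = 0$. Define, for $x \in X$ and $\mu \in \mathbb{R}_+$, $$g(x,\mu) = \begin{cases} f(x), & x \in \Omega,\ \mu = 0, \\ +\infty, & x \notin \Omega,\ \mu = 0, \\ f(x) + \frac{1}{\mu}\,\phi\big(d(y_0,\Phi(x))^2\big), & \mu > 0, \end{cases} \qquad F_\lambda(x,\mu) = g(x,\mu) + \lambda \beta(\mu), \quad \lambda \ge 0,$$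 with the convention $0 \cdot (+\infty) = 0$. Exactness: for a point of local minimum $x^* \in \operatorname{dom} f$ of the problem, $F_\lambda$ is called (locally) exact at $x^*$ if there exists $\lambda \ge 0$ such that $(x^*,0)$ is a point of local minimum of $F_\lambda$ on $A \times \mathbb{R}_+$. The greatest lower bound of all such $\lambda$ is denoted $\lambda(x^* )$. Metric subregularity: $\Phi$ is metrically subregular with respect to $A$ with constant $a > 0$ at $(\overline{x},\overline{y})$, where $\overline{x} \in A$ and $\overline{y} \in \Phi(\overline{x})$, if there exists a neighbourhood $U$ of $\overline{x}$ such that $d(\overline{y},\Phi(x)) \ge a\, d(x, \Phi^{-1}(\overline{y}) \cap A)$ for all $x \in U \cap A$. ''Lipschitz continuous near $x^*$ (with constant $L$)'' means that $f$ is real-valued and Lipschitz continuous (with constant $L$) on some neighbourhood of $x^*$. *)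

(* Defs.v *)
From mathcomp Require Import all_boot all_order all_algebra.
From mathcomp Require Import all_classical all_reals.
From mathcomp Require Import ereal topology normedtype.
Set Implicit Arguments.
Unset Strict Implicit.
Unset Printing Implicit Defensive.
Import Order.TTheory GRing.Theory Num.Theory.
Import numFieldNormedType.Exports.

Local Open Scope classical_set_scope.
Local Open Scope ring_scope.
Local Open Scope ereal_scope.

(* The infimum is taken in the extended reals, so the value is +oo when C is
   empty. *)
Definition set_dist (R : realType) (T : metricType R) (x : T) (C : set T)
    : \bar R :=
  ereal_inf [set (mdist x z)%:E | z in C].

Definition setval_inv (S T : Type) (Phi : S -> set T) (y : T) : set S :=
  [set x | Phi x y].

Definition local_min_on (R : realType) (T : topologicalType) (S : set T)
    (h : T -> \bar R) (x : T) : Prop :=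
  S x /\ \forall z \near x, S z -> h x <= h z.

Definition lipschitz_near (R : realType) (X : metricType R) (f : X -> \bar R)
    (x : X) (L : R) : Prop :=
  exists2 U : set X, nbhs x U &
    (forall u, U u -> f u \is a fin_num) /\
    (forall u v, U u -> U v ->
       (`|fine (f u) - fine (f v)| <= L * mdist u v)%R).

Definition metrically_subregular (R : realType) (X Y : metricType R)
    (A : set X) (Phi : X -> set Y) (a : R) (xbar : X) (ybar : Y) : Prop :=
  [/\ A xbar, Phi xbar ybar &
      \forall x \near xbar, A x ->
        a%:E * set_dist x (setval_inv Phi ybar `&` A)
          <= set_dist ybar (Phi x)].

Definition feasible (R : realType) (X Y : metricType R) (A : set X)
    (Phi : X -> set Y) (y0 : Y) : set X :=
  setval_inv Phi y0 `&` A.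

(* Only meaningful for 0 <= mu; negative mu are outside the domain
   A `*` [set mu | 0 <= mu] on which the penalty function is minimized. *)
Definition penalty_g (R : realType) (X Y : metricType R) (A : set X)
    (Phi : X -> set Y) (y0 : Y) (f : X -> \bar R) (phi : \bar R -> \bar R)
    (x : X) (mu : R) : \bar R :=
  if mu == 0%R then
    if x \in feasible A Phi y0 then f x else +oo
  else f x + (mu^-1)%:E * phi (set_dist y0 (Phi x) ^+ 2).

(* The library's product satisfies 0 * +oo = 0, as needed for lam = 0. *)
Definition penalty_F (R : realType) (X Y : metricType R) (A : set X)
    (Phi : X -> set Y) (y0 : Y) (f : X -> \bar R) (phi : \bar R -> \bar R)
    (beta : R -> \bar R) (lam : R) (x : X) (mu : R) : \bar R :=
  penalty_g A Phi y0 f phi x mu + lam%:E * beta mu.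

Definition exact_params (R : realType) (X Y : metricType R) (A : set X)
    (Phi : X -> set Y) (y0 : Y) (f : X -> \bar R) (phi : \bar R -> \bar R)
    (beta : R -> \bar R) (xs : X) : set R :=
  [set lam | (0 <= lam)%R /\
     local_min_on (A `*` [set mu : R | (0 <= mu)%R])
       (fun p : X * R => penalty_F A Phi y0 f phi beta lam p.1 p.2)
       (xs, 0%R)].

Definition penalty_exact (R : realType) (X Y : metricType R) (A : set X)
    (Phi : X -> set Y) (y0 : Y) (f : X -> \bar R) (phi : \bar R -> \bar R)
    (beta : R -> \bar R) (xs : X) : Prop :=
  exists lam : R, exact_params A Phi y0 f phi beta xs lam.

(* Extended infimum: +oo, rather than a default real, if no parameter is
   exact. *)
Definition least_exact_param (R : realType) (X Y : metricType R) (A : set X)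
    (Phi : X -> set Y) (y0 : Y) (f : X -> \bar R) (phi : \bar R -> \bar R)
    (beta : R -> \bar R) (xs : X) : \bar R :=
  ereal_inf [set lam%:E | lam in exact_params A Phi y0 f phi beta xs].

(* Main.v *)
Require Import Defs.
From mathcomp Require Import all_boot all_order all_algebra.
From mathcomp Require Import all_classical all_reals.
From mathcomp Require Import ereal topology normedtype.
From mathcomp Require Import ring lra.
Set Implicit Arguments.
Unset Strict Implicit.
Unset Printing Implicit Defensive.
Import Order.TTheory GRing.Theory Num.Theory.
Import metricType_numDomainType.
Import numFieldNormedType.Exports.
Local Open Scope classical_set_scope.
Local Open Scope ring_scope.
Local Open Scope ereal_scope.

(** Write D for the distance from x to the feasible set, and let x in A be
    close to xs and mu > 0 small.  Three local estimates combine.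

    - Exact penalization of a Lipschitz function by the distance to the
      constraint set: f x >= f xs - L D
      ([local_min_exact_penalization]).
    - Metric subregularity gives d(y0, Phi x) >= a D, so the growth of phi near
      0 gives phi (d(y0, Phi x)^2) >= phi0 a^2 D^2 ([growth_at_square]).
    - The growth of beta gives lambda beta(mu) >= lambda beta0 mu.

    Hence F_lambda(x, mu) is at least
    f xs - L D + c D^2 / mu + lambda beta0 mu, where c = phi0 a^2.  By the
    inequality of arithmetic and geometric means the last two terms dominate
    2 sqrt(c lambda beta0) D, and this cancels the loss L D as soon as
    lambda >= L^2 / (4 c beta0).  At that value the inequality needed is
    [le_quad_over_lin].  So the value itself is an exact parameter, which gives
    exactness and the bound on the least parameter at once.  The smoothing by
    1/mu and the square of the distance is thus no obstacle to exactness: the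
    minimum over mu of c D^2 / mu + lambda beta0 mu is linear in D.  On the
    slice mu = 0 the penalty function is f on the feasible set and +oo elsewhere,
    so there the claim is the local minimality of xs. *)

Lemma set_dist_ge0 (R : realType) (T : metricType R) (x : T) (C : set T) :
  0 <= set_dist x C.
Proof. by apply: le_ereal_inf_tmp => _ [z _ <-]; rewrite lee_fin mdist_ge0. Qed.

Lemma set_dist_le (R : realType) (T : metricType R) (x z : T) (C : set T) :
  C z -> set_dist x C <= (mdist x z)%:E.
Proof. by move=> Cz; apply: ereal_inf_lbound; exists z. Qed.

Lemma set_dist_fin_num (R : realType) (T : metricType R) (x z : T)
    (C : set T) :
  C z -> set_dist x C \is a fin_num.
Proof.
move=> Cz; rewrite ge0_fin_numE ?set_dist_ge0//.
exact: le_lt_trans (set_dist_le x Cz) (ltry _).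
Qed.

(** Multiplication by L commutes with the infimum that defines the distance.
    The point z makes that distance finite, so that [fine] keeps its value, and
    settles L = 0, where dividing by L is impossible. *)
Lemma le_mul_set_dist (R : realType) (T : metricType R) (x z : T) (C : set T)
    (L r : R) :
  (0 <= L)%R -> C z -> (forall u, C u -> (r <= L * mdist x u)%R) ->
  (r <= L * fine (set_dist x C))%R.
Proof.
move=> L0 Cz rL; move: L0; rewrite le_eqVlt => /orP[/eqP L0|L0].
  by have := rL z Cz; rewrite -L0 !mul0r.
rewrite mulrC -ler_pdivrMr// -lee_fin fineK ?(set_dist_fin_num _ Cz)//.
apply: le_ereal_inf_tmp => _ [u Cu <-].
by rewrite lee_fin ler_pdivrMr// mulrC rL.
Qed.

(** Comparing x with a point z of C costs at most L d(x, z), and f z >= f xs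
    when z is close to xs; taking the infimum over z gives the estimate.  Points
    z far from xs are harmless because xs, itself in C, is then closer to x
    than z is. *)
Lemma local_min_exact_penalization (R : realType) (X : metricType R)
    (C : set X) (f : X -> \bar R) (xs : X) (L : R) :
  (0 <= L)%R -> local_min_on C f xs -> lipschitz_near f xs L ->
  \forall x \near xs, f x \is a fin_num /\
    (fine (f xs) - L * fine (set_dist x C) <= fine (f x))%R.
Proof.
move=> L0 [Cxs fmin] [U Uxs [Ufin Ulip]].
have /nbhs_mdistP[r /= r0 rP] : \forall z \near xs, U z /\ (C z -> f xs <= f z).
  by near=> z; split; near: z.
apply/nbhs_mdistP; exists (r / 2)%R => /=; first by rewrite divr_gt0.
move=> x /= xr; have xsU := nbhs_singleton Uxs.
have [Ux _] : U x /\ (C x -> f xs <= f x) by apply: rP => /=; lra.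
split; first exact: Ufin.
rewrite lerBlDr -lerBlDl; apply: (le_mul_set_dist L0 Cxs) => z Cz.
have [xz|zx] := lerP (mdist xs x) (mdist x z).
  (* Here z need not lie in U, so x is compared with xs directly. *)
  apply: le_trans (ler_norm _) (le_trans (Ulip _ _ xsU Ux) _).
  exact: ler_wpM2l.
(* Here d(xs, z) <= d(xs, x) + d(x, z) < 2 d(xs, x) < r. *)
have [Uz fz] : U z /\ (C z -> f xs <= f z).
  by apply: rP => /=; apply: le_lt_trans (metric_triangle xs x z) _; lra.
have : (fine (f xs) <= fine (f z))%R by rewrite fine_le ?Ufin//; exact: fz.
have := Ulip _ _ Uz Ux; rewrite metric_sym => /(le_trans (ler_norm _)).
lra.
Unshelve. all: by end_near. Qed.

(** The inequality of arithmetic and geometric means, in the form where the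
    difference of the two sides is (2 c D - L mu)^2 / (4 c mu). *)
Lemma le_quad_over_lin (R : realFieldType) (L D c mu : R) :
  (0 < c -> 0 < mu ->
  L * D <= mu^-1 * (c * D ^+ 2) + L ^+ 2 / (4 * c) * mu)%R.
Proof.
move=> c0 mu0; rewrite -subr_ge0.
suff -> : (mu^-1 * (c * D ^+ 2) + L ^+ 2 / (4 * c) * mu - L * D =
    (2 * c * D - L * mu) ^+ 2 / (4 * c * mu))%R.
  by rewrite divr_ge0 ?sqr_ge0// !mulr_ge0// ltW.
by field; rewrite !gt_eqF.
Qed.

(** The growth of phi is only known on [0, t0], while s may be large or
    infinite; monotonicity moves the estimate down to d^2, which lies in that
    interval. *)
Lemma growth_at_square (R : realType) (phi : \bar R -> \bar R)
    (phi0 t0 d : R) (s : \bar R) :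
  (forall s t, 0 <= s -> s <= t -> phi s <= phi t) ->
  (forall t : R, (0 <= t <= t0)%R -> (phi0 * t)%:E <= phi t%:E) ->
  (0 <= d)%R -> (d ^+ 2 <= t0)%R -> d%:E <= s ->
  (phi0 * d ^+ 2)%:E <= phi (s ^+ 2).
Proof.
move=> phi_nd phi_gr d0 dt0 ds.
apply: (le_trans (phi_gr (d ^+ 2)%R _)); first by rewrite sqr_ge0.
apply: phi_nd; first by rewrite lee_fin sqr_ge0.
by rewrite EFin_expe !expe2; apply: lee_pmul.
Qed.

Theorem theorem3 (R : realType) (X Y : metricType R) (A : set X)
  (Phi : X -> set Y) (y0 : Y) (f : X -> \bar R)
  (phi : \bar R -> \bar R) (beta : R -> \bar R)
  (A_neq0 : A !=set0)
  (Phi_closed : forall x, closed (Phi x))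
  (f_neqNy : forall x, f x != -oo)
  (Omega_neq0 : feasible A Phi y0 !=set0)
  (f_bounded_below :
     exists m : R, forall x, feasible A Phi y0 x -> m%:E <= f x)
  (phi_ge0 : forall t, 0 <= t -> 0 <= phi t)
  (phi_nondecr : forall s t, 0 <= s -> s <= t -> phi s <= phi t)
  (phi_eq0 : forall t, 0 <= t -> (phi t = 0 <-> t = 0))
  (beta_ge0 : forall mu : R, (0 <= mu)%R -> 0 <= beta mu)
  (beta_nondecr :
     forall mu nu : R, (0 <= mu)%R -> (mu <= nu)%R -> beta mu <= beta nu)
  (beta_eq0 : forall mu : R, (0 <= mu)%R -> (beta mu = 0 <-> mu = 0%R))
  (xs : X)
  (xs_dom : f xs < +oo)
  (xs_min : local_min_on (feasible A Phi y0) f xs)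
  (L : R) (L_ge0 : (0 <= L)%R) (f_lip : lipschitz_near f xs L)
  (a : R) (a_gt0 : (0 < a)%R)
  (Phi_subreg : metrically_subregular A Phi a xs y0)
  (phi0 t0 : R) (phi0_gt0 : (0 < phi0)%R) (t0_gt0 : (0 < t0)%R)
  (phi_growth :
     forall t : R, (0 <= t <= t0)%R -> (phi0 * t)%:E <= phi t%:E)
  (beta0 mubar : R) (beta0_gt0 : (0 < beta0)%R) (mubar_gt0 : (0 < mubar)%R)
  (beta_growth :
     forall mu : R, (0 <= mu <= mubar)%R -> (beta0 * mu)%:E <= beta mu) :
  penalty_exact A Phi y0 f phi beta xs /\
  least_exact_param A Phi y0 f phi beta xs
    <= (L ^+ 2 / (4 * phi0 * beta0 * a ^+ 2))%:E.
Proof.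
set lam0 := (L ^+ 2 / (4 * phi0 * beta0 * a ^+ 2))%R.
have lam0_ge0 : (0 <= lam0)%R.
  by rewrite divr_ge0 ?sqr_ge0// !mulr_ge0 ?sqr_ge0// ltW.
suff exact_lam0 : exact_params A Phi y0 f phi beta xs lam0.
  split; first by exists lam0.
  by apply: ereal_inf_lbound; exists lam0.
have [Oxs fmin] := xs_min; have [Axs _ subreg] := Phi_subreg.
have fxs : f xs \is a fin_num by rewrite fin_numE f_neqNy lt_eqF.
have Fxs : penalty_F A Phi y0 f phi beta lam0 xs 0%R = f xs.
  rewrite /penalty_F /penalty_g eqxx mem_set//.
  by rewrite (beta_eq0 _ (lexx _)).2// mule0 adde0.
split=> //; split; first by split=> //=.
rewrite /= Fxs.
have xnear : \forall x \near xs, [/\ f x \is a fin_num /\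
    (fine (f xs) - L * fine (set_dist x (feasible A Phi y0)) <= fine (f x))%R,
    A x -> a%:E * set_dist x (setval_inv Phi y0 `&` A)
          <= set_dist y0 (Phi x),
    ((a * mdist xs x) ^+ 2 <= t0)%R & feasible A Phi y0 x -> f xs <= f x].
  (* The radius below which a D <= a d(xs, x) keeps (a D)^2 under t0. *)
  have rt0 : (0 < Num.sqrt t0 / a)%R by rewrite divr_gt0 ?sqrtr_gt0.
  near=> x; split; near: x => //.
  - exact: local_min_exact_penalization.
  - apply/nbhs_mdistP; exists (Num.sqrt t0 / a)%R => //= x /=.
    rewrite ltr_pdivlMr// mulrC => /ltW axt.
    rewrite -(sqr_sqrtr (ltW t0_gt0)) ler_pXn2r ?nnegrE ?sqrtr_ge0//.
    by rewrite mulr_ge0 ?mdist_ge0 ?ltW.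
have munear : \forall mu \near (0%R : R), (`|mu| <= mubar)%R by exact: nbhs0_le.
apply: (ex_intro2 _ _ (_, _) (conj xnear munear)).
move=> [x mu] /= [[[fx fxge] subx xt0 fminx] mule] [Ax mu0].
move: mu0; rewrite le_eqVlt => /orP[/eqP <-|mu0].
  rewrite /penalty_F /penalty_g eqxx (beta_eq0 _ (lexx _)).2// mule0 adde0.
  case: ifPn => [|_]; last by rewrite leey.
  by move=> /set_mem; exact: fminx.
rewrite /penalty_F /penalty_g gt_eqF//.
set D := fine (set_dist x (feasible A Phi y0)) in fxge.
have DE : D%:E = set_dist x (feasible A Phi y0).
  by rewrite fineK// (set_dist_fin_num _ Oxs).
have D0 : (0 <= D)%R by rewrite fine_ge0// set_dist_ge0.
(* xs is feasible, so D tends to 0 as x tends to xs. *)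
have Dle : (D <= mdist xs x)%R by rewrite -lee_fin DE metric_sym set_dist_le.
have phige : (phi0 * (a * D) ^+ 2)%:E <= phi (set_dist y0 (Phi x) ^+ 2).
  apply: growth_at_square phi_nondecr phi_growth _ _ _.
  - by rewrite mulr_ge0// ltW.
  - apply: le_trans xt0.
    rewrite ler_pXn2r ?nnegrE ?mulr_ge0 ?mdist_ge0// ?(ltW a_gt0)//.
    by rewrite ler_wpM2l// ltW.
  - by rewrite EFinM DE; exact: subx.
have betage : (beta0 * mu)%:E <= beta mu.
  by rewrite beta_growth// ltW//= -(gtr0_norm mu0).
apply: (@le_trans _ _ ((fine (f x))%:E + (mu^-1)%:E * (phi0 * (a * D) ^+ 2)%:E
                       + lam0%:E * (beta0 * mu)%:E)); last first.
  rewrite leeD//; last by rewrite lee_wpmul2l// lee_fin.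
  by rewrite fineK// leeD2l// lee_wpmul2l// lee_fin invr_ge0 ltW.
rewrite -(fineK fxs) -!EFinM -!EFinD lee_fin.
have := @le_quad_over_lin _ L D (phi0 * a ^+ 2)%R mu.
rewrite mulr_gt0 ?exprn_gt0// => /(_ isT mu0).
(* lam0 is chosen so that beta0 cancels. *)
have -> : (lam0 * (beta0 * mu) = L ^+ 2 / (4 * (phi0 * a ^+ 2)) * mu)%R.
  by rewrite /lam0; field; rewrite !gt_eqF.
rewrite exprMn mulrA; lra.
Unshelve. all: by end_near. Qed.
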